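(* Let $k$ be a commutative ring with unity, $A$ an associative $k$-algebra, $M,N$ left $A$-modules, $\phi:M\to N$ an $A$-module homomorphism, and $(\xi_t,\eta_t,\phi_t)$ a deformation of order $n$ of $\phi$. Then the $(n+1)$th obstruction cochain $Ob_{n+1}(\phi_t)\in C^2(\phi)$ is a 2-cocycle, i.e. $d^2\,Ob_{n+1}(\phi_t)=0$.
   Context: Write $\otimes=\otimes_k$. For an $A$-bimodule $F$, put $C^n(A;F)=\mathrm{Hom}_k(A^{\otimes n},F)$ for $n\ge 0$ (so $C^0(A;F)=F$), with the Hochschild coboundary $\delta^n:C^n(A;F)\to C^{n+1}(A;F)$ given for $n\ge1$ by $$\delta^n f(x_1,\dots,x_{n+1})=x_1f(x_2,\dots,x_{n+1})+\sum_{i=1}^{n}(-1)^i f(x_1,\dots,x_ix_{i+1},\dots,x_{n+1})+(-1)^{n+1}f(x_1,\dots,x_n)x_{n+1},$$ and $\delta^0(m)(a)=am-ma$. For left $A$-modules $P,Q$, $\mathrm{Hom}_k(P,Q)$ is the $A$-bimodule with $(rf)(m)=r(f(m))$, $(fs)(m)=f(sm)$; $\mathrm{End}(P)=\mathrm{Hom}_k(P,P)$. For $n\ge 1$ let $C^n(\phi)=C^n(A;\mathrm{End}(M))\oplus C^n(A;\mathrm{End}(N))\oplus C^{n-1}(A;\mathrm{Hom}_k(M,N))$ and $d^n:C^n(\phi)\to C^{n+1}(\phi)$, $$d^n(u,v,w)=(\delta^n u,\ \delta^n v,\ \phi u-v\phi-\delta^{n-1}w),$$ where $(\phi u)(x_1,\dots,x_n)(m)=\phi(u(x_1,\dots,x_n)(m))$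 and $(v\phi)(x_1,\dots,x_n)(m)=v(x_1,\dots,x_n)(\phi(m))$. Let $\xi:A\to\mathrm{End}(M)$, $\xi(r)m=rm$, be the action map of $M$. A deformation of order $n$ of $M$ is $\xi_t=\sum_{i=0}^n\xi_it^i$ with $\xi_i\in\mathrm{Hom}_k(A,\mathrm{End}(M))$, $\xi_0=\xi$, and $\xi_t(rs)=\xi_t(r)\xi_t(s)$ modulo $t^{n+1}$, i.e. $\xi_l(rs)=\sum_{i+j=l}\xi_i(r)\xi_j(s)$ for all $r,s\in A$, $0\le l\le n$; similarly for $N$. A deformation of order $n$ of $\phi$ is a triple $(\xi_t,\eta_t,\phi_t)$ where $\xi_t=\sum_{i=0}^n\xi_it^i$, $\eta_t=\sum_{i=0}^n\eta_it^i$ are deformations of order $n$ of $M$ and $N$, and $\phi_t=\sum_{i=0}^n\phi_it^i$ with $\phi_i\in\mathrm{Hom}_k(M,N)$, $\phi_0=\phi$, and $\phi_t(\xi_t(r)m)=\eta_t(r)\phi_t(m)$ modulo $t^{n+1}$, i.e. $\sum_{i+j=l}\phi_i(\xi_j(r)m)=\sum_{i+j=l}\eta_i(r)(\phi_j(m))$ for all $r\in A$, $m\in M$, $0\le l\le n$. The $(n+1)$th obstruction cochain of $(\xi_t,\eta_t,\phi_t)$ is $Ob_{n+1}(\phi_t)=(O_1,O_2,O_3)\in C^2(\phi)$ with, for $a,b\in A$ (all sums over $i+j=n+1$, $i,j>0$), $$O_1(a,b)=-\sum\xi_i(a)\xi_j(b),\qquad O_2(a,b)=-\sum\eta_i(a)\eta_j(b),\qquad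 O_3(a)=\sum\eta_i(a)\circ\phi_j-\sum\phi_i\circ\xi_j(a).$$ *)

(* Defs.v *)
From HB Require Import structures.
From mathcomp Require Import all_boot all_order all_algebra.
From mathcomp Require Import boolp functions.

Set Implicit Arguments.
Unset Strict Implicit.
Unset Printing Implicit Defensive.

Import GRing.Theory.
Local Open Scope ring_scope.

Section LinearMaps.
Variables (k : comPzRingType) (P Q : lmodType k).
Implicit Types f g h : {linear P -> Q}.

Lemma linear_ext f g : f =1 g -> f = g.
Proof.
case: f g => [f [[x] [y]]] [g [[x'] [y']]] /funext /= E.
by subst g; congr (GRing.Linear.Pack (GRing.Linear.Class _ _));
  congr (_ _); exact: Prop_irrelevance.
Qed.

(* Hom_k(P, Q) is {linear P -> Q}, with the pointwise k-module structure. *)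
HB.instance Definition _ := gen_eqMixin {linear P -> Q}.
HB.instance Definition _ := gen_choiceMixin {linear P -> Q}.

Definition lin_add f g : {linear P -> Q} := f \+ g.
Definition lin_opp f : {linear P -> Q} := \- f.
Definition lin_zero : {linear P -> Q} := \0.
Definition lin_scale (c : k) f : {linear P -> Q} := c \*: f.

Lemma lin_addA : associative lin_add.
Proof. by move=> f g h; apply: linear_ext => x /=; rewrite addrA. Qed.
Lemma lin_addC : commutative lin_add.
Proof. by move=> f g; apply: linear_ext => x /=; rewrite addrC. Qed.
Lemma lin_add0r : left_id lin_zero lin_add.
Proof. by move=> f; apply: linear_ext => x /=; rewrite add0r. Qed.
Lemma lin_addNr : left_inverse lin_zero lin_opp lin_add.
Proof. by move=> f; apply: linear_ext => x /=; rewrite addNr. Qed.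

HB.instance Definition _ :=
  GRing.isZmodule.Build {linear P -> Q} lin_addA lin_addC lin_add0r lin_addNr.

Lemma lin_scaleA c d f : lin_scale c (lin_scale d f) = lin_scale (c * d) f.
Proof. by apply: linear_ext => x /=; rewrite scalerA. Qed.
Lemma lin_scale1r : left_id 1 lin_scale.
Proof. by move=> f; apply: linear_ext => x /=; rewrite scale1r. Qed.
Lemma lin_scaleDr : right_distributive lin_scale +%R.
Proof. by move=> c f g; apply: linear_ext => x /=; rewrite scalerDr. Qed.
Lemma lin_scaleDl f : {morph lin_scale^~ f : c d / c + d}.
Proof. by move=> c d; apply: linear_ext => x /=; rewrite scalerDl. Qed.

HB.instance Definition _ := GRing.Zmodule_isLmodule.Build k {linear P -> Q}
  lin_scaleA lin_scale1r lin_scaleDr lin_scaleDl.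

Lemma lin_addE f g x : (f + g) x = f x + g x. Proof. by []. Qed.
Lemma lin_oppE f x : (- f) x = - f x. Proof. by []. Qed.
Lemma lin_zeroE x : (0 : {linear P -> Q}) x = 0. Proof. by []. Qed.
Lemma lin_scaleE c f x : (c *: f) x = c *: f x. Proof. by []. Qed.
Lemma lin_sumE (I : Type) (r : seq I) (p : pred I)
    (F : I -> {linear P -> Q}) x :
  (\sum_(i <- r | p i) F i) x = \sum_(i <- r | p i) F i x.
Proof. by elim/big_rec2: _ => //= i y z _ <-. Qed.

End LinearMaps.

(* Neither A nor its modules are assumed unital, so algType k and            *)
(* lmodType A give particular cases. Bilinear maps are given in curried      *)
(* form, as elements of Hom_k(U, Hom_k(V, W)).                               *)
Record assocAlgebra (k : comPzRingType) := AssocAlgebra {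
  alg_sort :> lmodType k;
  amul : {linear alg_sort -> {linear alg_sort -> alg_sort}};
  amulA : forall a b c : alg_sort, amul (amul a b) c = amul a (amul b c)
}.
Notation "a ** b" := (amul _ a b) (at level 40, left associativity).

Section Modules.
Variables (k : comPzRingType) (A : assocAlgebra k).

(* act is the action map r |-> (m |-> r m), from A to End(M); bilinearity of *)
(* (r, m) |-> r m is expressed by the type of act.                           *)
Record leftModule := LeftModule {
  mod_sort :> lmodType k;
  act : {linear A -> {linear mod_sort -> mod_sort}};
  actM : forall (r s : A) (m : mod_sort), act (r ** s) m = act r (act s m)
}.

Record moduleHom (M N : leftModule) := ModuleHom {
  mhom_linear :> {linear M -> N};
  mhom_act : forall (r : A) (m : M), mhom_linear (act M r m) = act N r (mhom_linear m)
}.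

(* lact a x = a x and ract a x = x a. *)
Record bimodule := Bimodule {
  bimod_sort :> lmodType k;
  lact : {linear A -> {linear bimod_sort -> bimod_sort}};
  ract : {linear A -> {linear bimod_sort -> bimod_sort}};
  lactM : forall (a b : A) (x : bimod_sort), lact (a ** b) x = lact a (lact b x);
  ractM : forall (a b : A) (x : bimod_sort), ract (a ** b) x = ract b (ract a x);
  lractA : forall (a b : A) (x : bimod_sort), lact a (ract b x) = ract b (lact a x)
}.

Section HomBimodule.
Variables P Q : leftModule.
Notation H := {linear P -> Q}.

Definition homl0 (r : A) (f : H) : H := act Q r \o f.
Definition homr0 (s : A) (f : H) : H := f \o act P s.

Lemma homl0_linear r : linear (homl0 r).
Proof. by move=> c f g; apply: linear_ext => m /=; rewrite linearP. Qed.
HB.instance Definition _ r :=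
  GRing.isLinear.Build k H H _ (homl0 r) (homl0_linear r).
Lemma homr0_linear s : linear (homr0 s).
Proof. by move=> c f g; exact: linear_ext. Qed.
HB.instance Definition _ s :=
  GRing.isLinear.Build k H H _ (homr0 s) (homr0_linear s).

Definition homl (r : A) : {linear H -> H} := homl0 r.
Definition homr (s : A) : {linear H -> H} := homr0 s.

Lemma homl_linear : linear homl.
Proof.
move=> c r s; apply: linear_ext => f; apply: linear_ext => m /=.
by rewrite linearP.
Qed.
HB.instance Definition _ :=
  GRing.isLinear.Build k A {linear H -> H} _ homl homl_linear.
Lemma homr_linear : linear homr.
Proof.
move=> c r s; apply: linear_ext => f; apply: linear_ext => m /=.
by rewrite !linearP.
Qed.
HB.instance Definition _ :=
  GRing.isLinear.Build k A {linear H -> H} _ homr homr_linear.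

Lemma homlM (a b : A) (f : H) : homl (a ** b) f = homl a (homl b f).
Proof. by apply: linear_ext => m /=; rewrite actM. Qed.
Lemma homrM (a b : A) (f : H) : homr (a ** b) f = homr b (homr a f).
Proof. by apply: linear_ext => m /=; rewrite actM. Qed.
Lemma homlrA (a b : A) (f : H) : homl a (homr b f) = homr b (homl a f).
Proof. exact: linear_ext. Qed.

(* Hom_k(P, Q) with (r f)(m) = r (f m) and (f s)(m) = f (s m). *)
Definition homBimodule : bimodule :=
  @Bimodule H homl homr homlM homrM homlrA.

Lemma hom_lactE r (f : H) m : (lact homBimodule r f : H) m = act Q r (f m).
Proof. by []. Qed.
Lemma hom_ractE s (f : H) m : (ract homBimodule s f : H) m = f (act P s m).
Proof. by []. Qed.

End HomBimodule.

Definition update n (x : 'I_n -> A) (i : 'I_n) (a : A) : 'I_n -> A :=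
  @dfwith 'I_n (fun=> A) x i a.

Lemma updateE n (x : 'I_n -> A) i a j :
  update x i a j = if j == i then a else x j.
Proof.
have [->|ji] := eqVneq j i; first exact: dfwith_in.
by rewrite /update dfwith_out // eq_sym.
Qed.

Section Cochains.
Variable F : bimodule.

Definition multilinear n : {pred ('I_n -> A) -> F} :=
  fun f => `[< forall x i, linear (fun a => f (update x i a)) >].

(* Hom_k(A^(x)n, F), presented by the universal property of A^(x)n: its      *)
(* elements are the k-multilinear maps A^n -> F.                             *)
Record cochain n := Cochain {
  cochain_fun :> ('I_n -> A) -> F;
  cochain_multilinear : cochain_fun \in @multilinear n
}.

Lemma multilinear_submod n : submod_closed (@multilinear n).
Proof.
split; first by apply/asboolP => x i c a b; rewrite scaler0 addr0.
move=> c f g /asboolP fP /asboolP gP; apply/asboolP => x i d a b.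
rewrite !addrfctE !scalrfctE fP gP !scalerDr !scalerA [c * d]mulrC.
by rewrite addrACA.
Qed.
HB.instance Definition _ n :=
  GRing.isSubmodClosed.Build k _ (@multilinear n) (multilinear_submod n).

HB.instance Definition _ n := [isSub for @cochain_fun n].
HB.instance Definition _ n := [Choice of cochain n by <:].
HB.instance Definition _ n := [SubChoice_isSubLmodule of cochain n by <:].

(* x_i and x_(i+1) replaced by their product *)
Definition contract n (i : 'I_n) (x : 'I_n.+1 -> A) : 'I_n -> A := fun j =>
  if (j < i)%N then x (widen_ord (leqnSn n) j)
  else if j == i then x (widen_ord (leqnSn n) j) ** x (lift ord0 j)
  else x (lift ord0 j).

(* Indices start at 0, so that the sum is over i < n, with sign (-1)^(i+1). *)
(* For n = 0 this is a |-> a m - m a, with m the value of f.                *)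
Definition coboundary_fun n (f : ('I_n -> A) -> F) (x : 'I_n.+1 -> A) : F :=
  lact F (x ord0) (f (fun j => x (lift ord0 j)))
  + \sum_(i < n) (-1) ^+ i.+1 *: f (contract i x)
  + (-1) ^+ n.+1 *: ract F (x ord_max) (f (fun j => x (widen_ord (leqnSn n) j))).

Lemma tail_update n (x : 'I_n.+1 -> A) i a :
  (fun j => update x i a (lift ord0 j)) =
  if unlift ord0 i is Some i' then update (fun j => x (lift ord0 j)) i' a
  else fun j => x (lift ord0 j).
Proof.
by apply/funext => j; case: unliftP => [i'|] ->; rewrite !updateE.
Qed.

Lemma init_update n (x : 'I_n.+1 -> A) i a :
  (fun j => update x i a (widen_ord (leqnSn n) j)) =
  if unlift ord_max i is Some i'
  then update (fun j => x (widen_ord (leqnSn n) j)) i' a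
  else fun j => x (widen_ord (leqnSn n) j).
Proof.
have wE (j : 'I_n) : widen_ord (leqnSn n) j = lift ord_max j.
  by apply: val_inj; rewrite /= /bump leqNgt ltn_ord.
apply/funext => j; case: unliftP => [i'|] ->; rewrite !updateE wE.
  by rewrite (inj_eq lift_inj).
by rewrite eq_sym (negPf (neq_lift _ _)).
Qed.

Lemma contract_update n (l : 'I_n) (x : 'I_n.+1 -> A) (i : 'I_n.+1) :
  exists2 j : 'I_n, True & exists2 h : A -> A, linear h
    & forall a, contract l (update x i a) = update (contract l x) j (h a).
Proof.
have [il|li] := leqP i l.
  have ltin : (i < n)%N by exact: leq_ltn_trans il (ltn_ord l).
  exists (Ordinal ltin) => //.
  have [e|ne] := eqVneq (i : nat) l.
    exists (fun a => a ** x (lift ord0 l)) => [c a b|a].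
      by rewrite !linearP.
    apply/funext => j; rewrite /contract !updateE -!val_eqE /= /bump /= e.
    have [jl|lj|jl] := ltngtP j l; [by []|by rewrite gtn_eqF // add1n ltnW|].
    by rewrite add1n jl gtn_eqF //; congr (_ ** x _); apply: val_inj; rewrite /= jl.
  exists id => [c a b //|a].
  apply/funext => j; rewrite /contract !updateE -!val_eqE /= /bump /= add1n.
  have {ne}il' : (i < l)%N by rewrite ltn_neqAle ne.
  have [jl|lj|jl] := ltngtP j l.
  - by [].
  - have ij := ltn_trans il' lj.
    by rewrite (gtn_eqF ij) (gtn_eqF (leqW ij)).
  - by rewrite jl (gtn_eqF il') (gtn_eqF (leqW il')).
have i0 : (0 < i)%N by exact: leq_ltn_trans li.
have ltin : (i.-1 < n)%N by rewrite prednK // -ltnS.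
exists (Ordinal ltin) => //.
have [e|ne] := eqVneq (i : nat) l.+1.
  exists (fun a => x (widen_ord (leqnSn n) l) ** a) => [c a b|a].
    by rewrite linearP.
  apply/funext => j; rewrite /contract !updateE -!val_eqE /= /bump /= add1n e /=.
  have [jl|lj|jl] := ltngtP j l.
  - by rewrite ltn_eqF // ltnW.
  - by rewrite eqSS gtn_eqF.
  - rewrite jl eqxx ltn_eqF //; congr (x _ ** _); exact: val_inj.
have {ne}li' : (l.+1 < i)%N by rewrite ltn_neqAle eq_sym ne.
exists id => [c a b //|a].
apply/funext => j; rewrite /contract !updateE -!val_eqE /= /bump /= add1n.
have eS : (j.+1 == i :> nat) = (j == i.-1 :> nat) by rewrite -{1}(prednK i0) eqSS.
have [jl|lj|jl] := ltngtP j l.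
- by rewrite -eS (ltn_eqF (ltn_trans jl li)) (ltn_eqF (ltn_trans _ li')).
- by rewrite eS.
- by rewrite -eS jl (ltn_eqF li') (ltn_eqF li).
Qed.

Lemma coboundary_multilinear n (f : cochain n) :
  coboundary_fun f \in @multilinear n.+1.
Proof.
have fP x i c a b : f (update x i (c *: a + b)) =
    c *: f (update x i a) + f (update x i b).
  by have /asboolP := cochain_multilinear f; apply.
rewrite /coboundary_fun.
have -> : (fun x : 'I_n.+1 -> A =>
  lact F (x ord0) (f (fun j => x (lift ord0 j)))
  + \sum_(i < n) (-1) ^+ i.+1 *: f (contract i x)
  + (-1) ^+ n.+1 *:
      ract F (x ord_max) (f (fun j => x (widen_ord (leqnSn n) j)))) =
  (fun x => lact F (x ord0) (f (fun j => x (lift ord0 j))))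
  + \sum_(i < n) (-1) ^+ i.+1 *: (fun x => f (contract i x))
  + (-1) ^+ n.+1 *: (fun x =>
      ract F (x ord_max) (f (fun j => x (widen_ord (leqnSn n) j)))).
  by apply/funext => x; rewrite !addrfctE !scalrfctE fct_sumE.
rewrite rpredD ?rpredD ?rpredZ ?rpred_sum // => [|l _|].
- apply/asboolP => x i c a b; rewrite !tail_update.
  case: unliftP => [i'|] e.
    by rewrite !updateE e (negPf (neq_lift _ _)) fP linearP.
  by rewrite !updateE e eqxx !linearP.
- apply: rpredZ; apply/asboolP => x i c a b.
  have [j _ [h hP hE]] := contract_update l x i.
  by rewrite !hE hP fP.
- apply/asboolP => x i c a b; rewrite !init_update.
  case: unliftP => [i'|] e.
    by rewrite !updateE e (negPf (neq_lift _ _)) fP linearP.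
  by rewrite !updateE e eqxx !linearP.
Qed.

Definition coboundary n (f : cochain n) : cochain n.+1 :=
  Cochain (coboundary_multilinear f).

End Cochains.

Section ModuleCochains.
Variables M N : leftModule.

(* module_cochain n is C^n(phi) for n >= 1, with C^(n-1) in the third factor *)
Definition module_cochain n : zmodType :=
  (cochain (homBimodule M M) n * cochain (homBimodule N N) n
   * cochain (homBimodule M N) n.-1)%type.

Variable phi : moduleHom M N.

Definition postcomp_fun n (u : cochain (homBimodule M M) n) (x : 'I_n -> A) :
  {linear M -> N} := phi \o (u x : {linear M -> M}).
Definition precomp_fun n (v : cochain (homBimodule N N) n) (x : 'I_n -> A) :
  {linear M -> N} := (v x : {linear N -> N}) \o phi.

Lemma postcomp_multilinear n u :
  @postcomp_fun n u \in @multilinear (homBimodule M N) n.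
Proof.
apply/asboolP => x i c a b; apply: linear_ext => m.
have /asboolP uP := cochain_multilinear u.
by rewrite /postcomp_fun /= uP /= linearP.
Qed.
Lemma precomp_multilinear n v :
  @precomp_fun n v \in @multilinear (homBimodule M N) n.
Proof.
apply/asboolP => x i c a b; apply: linear_ext => m.
have /asboolP vP := cochain_multilinear v.
by rewrite /precomp_fun /= vP.
Qed.

(* phi u and v phi *)
Definition postcomp n u := Cochain (@postcomp_multilinear n u).
Definition precomp n v := Cochain (@precomp_multilinear n v).

(* d^n for n >= 1, indexed by the predecessor of n *)
Definition module_diff n (c : module_cochain n.+1) : module_cochain n.+2 :=
  let: (u, v, w) := c in
  (coboundary u, coboundary v, postcomp u - precomp v - coboundary w).

End ModuleCochains.

Record moduleDeformation n (M : leftModule) := ModuleDeformation {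
  mdef :> 'I_n.+1 -> {linear A -> {linear M -> M}};
  mdef0 : mdef ord0 = act M;
  mdefM : forall (l : 'I_n.+1) (r s : A),
    mdef l (r ** s) =
    \sum_(p : 'I_n.+1 * 'I_n.+1 | (p.1 + p.2 == l)%N)
      (mdef p.1 r \o mdef p.2 s : {linear M -> M})
}.

Record homDeformation n (M N : leftModule) (phi : moduleHom M N) :=
  HomDeformation {
  xi : moduleDeformation n M;
  eta : moduleDeformation n N;
  phit : 'I_n.+1 -> {linear M -> N};
  phit0 : phit ord0 = phi;
  phitM : forall (l : 'I_n.+1) (r : A) (m : M),
    \sum_(p : 'I_n.+1 * 'I_n.+1 | (p.1 + p.2 == l)%N) phit p.1 (xi p.2 r m) =
    \sum_(p : 'I_n.+1 * 'I_n.+1 | (p.1 + p.2 == l)%N) eta p.1 r (phit p.2 m)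
}.

Section Obstruction.
Variables (n : nat) (M N : leftModule).

(* pairs (i, j) with i + j = n + 1 and i, j > 0; these force i, j <= n *)
Definition obs_index (p : 'I_n.+1 * 'I_n.+1) :=
  [&& 0 < p.1, 0 < p.2 & p.1 + p.2 == n.+1]%N.

Definition obs_module_fun (D : moduleDeformation n M) (x : 'I_2 -> A) :
    {linear M -> M} :=
  - \sum_(p | obs_index p)
      (D p.1 (x ord0) \o D p.2 (x ord_max) : {linear M -> M}).

Lemma obs_module_multilinear D :
  obs_module_fun D \in @multilinear (homBimodule M M) 2.
Proof.
apply/asboolP => x i c a b; rewrite scalerN -opprD; congr (- _).
rewrite scaler_sumr -big_split; apply: eq_bigr => p _ /=.
apply: linear_ext => m /=; rewrite !updateE /=.
by have [->|->] : i = ord0 \/ i = ord_max;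
  [case: i => [[|[|[]]] ?] //; [left|right]; exact: val_inj|..];
  rewrite /= ?linearP /= ?linearP.
Qed.

Definition obs_module D : cochain (homBimodule M M) 2 :=
  Cochain (obs_module_multilinear D).

Variable phi : moduleHom M N.

Definition obs_hom_fun (D : homDeformation n phi) (x : 'I_1 -> A) : {linear M -> N} :=
  \sum_(p | obs_index p) (eta D p.1 (x ord0) \o phit D p.2 : {linear M -> N})
  - \sum_(p | obs_index p) (phit D p.1 \o xi D p.2 (x ord0) : {linear M -> N}).

Lemma obs_hom_multilinear D :
  obs_hom_fun D \in @multilinear (homBimodule M N) 1.
Proof.
apply/asboolP => x i c a b.
rewrite scalerBr addrACA -opprD !scaler_sumr -!big_split /=.
congr (_ - _); apply: eq_bigr => p _; apply: linear_ext => m /=;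
  by rewrite !updateE !ord1 /= !linearP /= ?linearP.
Qed.

Definition obs_hom D : cochain (homBimodule M N) 1 :=
  Cochain (obs_hom_multilinear D).

End Obstruction.

Definition obstruction n (M N : leftModule) (phi : moduleHom M N)
    (D : homDeformation n phi) : module_cochain M N 2 :=
  (obs_module (xi D), obs_module (eta D), obs_hom D).

End Modules.

(* Main.v *)
Require Import Defs.
From mathcomp Require Import all_boot all_order all_algebra.
From mathcomp Require Import boolp functions.
Import GRing.Theory.
Local Open Scope ring_scope.

(** Regard the deformation as polynomials in t and forget the truncation: write
X, Y and Phi for the polynomials given by xi, eta and phit, with no terms above
t^n. The defects
- R(a, b) = X(ab) - X(a)X(b), likewise R'(a, b) for Y, and
- S(a) = Y(a)Phi - Phi X(a)
then vanish up to order n, because that is what a deformation of order n means,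
and their coefficients of t^(n+1) are exactly the components O_1, O_2, O_3 of
the obstruction ([obs_moduleE], [obs_homE]): the terms with i = 0 or j = 0 of a
product contribute nothing in degree n+1.

Associativity of composition gives two identities between complete series,
whether or not the deformation equations hold ([mult_defect_cocycle] and
[hom_defect_coboundary]):
- X(a)R(b, c) - R(ab, c) + R(a, bc) - R(a, b)X(c) = 0,
- Phi R(a, b) - R'(a, b)Phi = Y(a)S(b) - S(ab) + S(a)X(b).
Take the coefficients of t^(n+1). As the defects start in degree n+1, every
factor X, Y or Phi next to one of them contributes only its constant term, which
is the action of M, the action of N, or phi. The identities become
delta O_1 = 0 (and delta O_2 = 0) and phi O_1 - O_2 phi = delta O_3, which is
the cocycle condition. *)

(** * Series of linear maps *)

Section Series.
Set Implicit Arguments.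
Unset Strict Implicit.
Variable k : comPzRingType.
Implicit Types P Q S T : lmodType k.

Definition series P Q : zmodType := nat -> {linear P -> Q}.

Definition comp_series P Q S (f : series Q S) (g : series P Q) : series P S :=
  fun l => \sum_(i < l.+1) (f i \o g (l - i)%N : {linear P -> S}).
Local Notation "f ⋆ g" := (comp_series f g) (at level 40, left associativity).

Lemma comp_seriesE P Q S (f : series Q S) (g : series P Q) l x :
  (f ⋆ g) l x = \sum_(i < l.+1) f i (g (l - i)%N x).
Proof. by rewrite /comp_series lin_sumE. Qed.

Lemma comp_seriesA P Q S T (f : series S T) (g : series Q S) (h : series P Q) :
  f ⋆ (g ⋆ h) = (f ⋆ g) ⋆ h.
Proof.
apply/funext => l; apply: linear_ext => x; rewrite !comp_seriesE.
(* j is the total degree of the f and g factors *)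
pose F (i j : nat) := f i (g (j - i)%N (h (l - j)%N x)).
transitivity (\sum_(i < l.+1) \sum_(j < l.+1 | (i <= j)%N) F i j).
  apply: eq_bigr => i _; rewrite comp_seriesE linear_sum /=.
  rewrite -subSn -1?ltnS //.
  rewrite -(big_mkord xpredT (fun j => f i (g j (h (l - i - j)%N x)))).
  rewrite -(big_mkord (fun j => (i <= j)%N) (F i)).
  transitivity (\sum_(i <= j < l.+1) F i j); last by rewrite (big_nat_widenl _ 0).
  rewrite -[X in _ = \sum_(X <= _ < _) _]add0n big_addn; apply: eq_bigr => j _.
  by rewrite /F addnK [(j + i)%N]addnC subnDA.
rewrite (exchange_big_dep xpredT) //=; apply: eq_bigr => j _.
by rewrite comp_seriesE (big_ord_widen_cond l.+1 xpredT (fun i => F i j)).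

Qed.

Lemma comp_seriesBl P Q S (f g : series Q S) (h : series P Q) :
  (f - g) ⋆ h = f ⋆ h - g ⋆ h.
Proof.
apply/funext => l; apply: linear_ext => x.
by rewrite lin_addE lin_oppE !comp_seriesE -sumrB.
Qed.

Lemma comp_seriesBr P Q S (f : series Q S) (g h : series P Q) :
  f ⋆ (g - h) = f ⋆ g - f ⋆ h.
Proof.
apply/funext => l; apply: linear_ext => x.
rewrite lin_addE lin_oppE !comp_seriesE -sumrB.
by apply: eq_bigr => i _; rewrite linearB.
Qed.

Definition vanishes P Q n (r : series P Q) : Prop := forall l, (l <= n)%N -> r l = 0.

(** A series that starts in degree n.+1 sees only the constant term of what it is
composed with, in that degree. This is what turns products of series into the
bimodule actions of the Hochschild coboundary. *)
Lemma comp_series_lead P Q S n (f : series Q S) (r : series P Q) x :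
  vanishes n r -> (f ⋆ r) n.+1 x = f 0%N (r n.+1 x).
Proof.
move=> r0; rewrite comp_seriesE big_ord_recl /= big1 ?addr0 ?subn0 // => i _.
by rewrite r0 ?linear0 // /= /bump add1n subSS leq_subr.
Qed.

Lemma lead_comp_series P Q S n (r : series Q S) (g : series P Q) x :
  vanishes n r -> (r ⋆ g) n.+1 x = r n.+1 (g 0%N x).
Proof.
move=> r0; rewrite comp_seriesE big_ord_recr /= big1 ?add0r ?subnn // => i _.
by rewrite r0 // -ltnS.
Qed.

(** Extension by zero beyond degree n, so that identities between series need
no truncation. *)
Definition poly_series P Q n (c : 'I_n.+1 -> {linear P -> Q}) : series P Q :=
  fun i => if (i <= n)%N then c (inord i) else 0.

Lemma poly_series_ord P Q n (c : 'I_n.+1 -> {linear P -> Q}) (i : 'I_n.+1) :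
  poly_series c i = c i.
Proof. by rewrite /poly_series -ltnS ltn_ord inord_val. Qed.

Lemma poly_series_out P Q n (c : 'I_n.+1 -> {linear P -> Q}) i :
  (n < i)%N -> poly_series c i = 0.
Proof. by rewrite /poly_series ltnNge => /negPf ->. Qed.

(** Links the product of series to the sums over pairs of bounded indices in the
deformation equations. It holds in every degree l: degree at most n gives the
equations themselves, degree n.+1 the obstruction. *)
Lemma comp_poly_seriesE P Q S n (c : 'I_n.+1 -> {linear Q -> S})
    (d : 'I_n.+1 -> {linear P -> Q}) l x :
  (poly_series c ⋆ poly_series d) l x =
  \sum_(p : 'I_n.+1 * 'I_n.+1 | (p.1 + p.2 == l)%N) c p.1 (d p.2 x).
Proof.
rewrite -(pair_big_dep xpredT (fun i j : 'I_n.+1 => (i + j == l)%N)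
  (fun i j => c i (d j x))) /=.
(* for each i only the index j = l - i counts, provided i <= l and l - i <= n *)
pose F i := poly_series c i (poly_series d (l - i)%N x).
transitivity (\sum_(i < n.+1 | (i <= l)%N) F i).
  rewrite comp_seriesE -(big_mkord xpredT F) -(big_mkord (fun i => i <= l)%N F).
  have [nl|ln] := leqP n l.
    rewrite (big_cat_nat (n := n.+1)) //= [X in _ + X](_ : _ = 0) ?addr0.
      rewrite big_nat_cond [RHS]big_nat_cond; apply: eq_bigl => i.
      by rewrite andbT ltnS; case: (leqP i n) => //= ni; rewrite (leq_trans ni nl).
    rewrite big_nat_cond big1 // => i /andP[/andP[ni _] _].
    by rewrite /F poly_series_out.
  by rewrite (big_nat_widen _ _ n.+1) // ltnS ltnW.
rewrite big_mkcond; apply: eq_bigr => i _; case: ifP => [il|li]; last first.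
  by rewrite big_pred0 // => j; apply: contraFF li => /eqP <-; rewrite leq_addr.
have [ln|nl] := leqP (l - i) n; last first.
  rewrite /F (poly_series_out _ nl) linear0 big_pred0 // => j.
  apply: contraTF nl => /eqP <-; by rewrite addKn -leqNgt -ltnS.
rewrite (big_pred1 (inord (l - i))) ?/F ?poly_series_ord => [|j].
  by rewrite /poly_series ln.
by rewrite -[RHS]val_eqE /= inordK // -[RHS](eqn_add2l i) subnKC.
Qed.

End Series.

(** * Defects of a truncated deformation *)

Section Defects.
Set Implicit Arguments.
Unset Strict Implicit.
Variables (k : comPzRingType) (A : assocAlgebra k) (n : nat).
Implicit Types (M N : leftModule A) (a b c : A).
Local Notation "f ⋆ g" := (comp_series f g) (at level 40, left associativity).

(** Indices bounded by n that add up to n.+1 are both positive. *)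
Lemma obs_indexE (p : 'I_n.+1 * 'I_n.+1) :
  obs_index p = (p.1 + p.2 == n.+1)%N.
Proof.
rewrite /obs_index; case: eqP => [e|_]; last by rewrite !andbF.
rewrite andbT !lt0n; apply/andP; split; apply/eqP => p0; move: e; rewrite p0.
  by rewrite add0n => e; have := ltn_ord p.2; rewrite e ltnn.
by rewrite addn0 => e; have := ltn_ord p.1; rewrite e ltnn.
Qed.

Definition mdef_series M (D : moduleDeformation n M) a : series M M :=
  poly_series (fun i => D i a).

Definition mult_defect M (D : moduleDeformation n M) a b : series M M :=
  mdef_series D (a ** b) - mdef_series D a ⋆ mdef_series D b.

Lemma mdef_series0 M (D : moduleDeformation n M) a :
  mdef_series D a 0%N = act M a.
Proof.
by rewrite -(mdef0 D) -(poly_series_ord (fun i => D i a) ord0).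
Qed.

Lemma mult_defect_vanishes M (D : moduleDeformation n M) a b :
  vanishes n (mult_defect D a b).
Proof.
move=> l ln; apply: linear_ext => x; rewrite lin_zeroE lin_addE lin_oppE.
have -> : l = Ordinal (ln : (l < n.+1)%N) by [].
by rewrite comp_poly_seriesE /mdef_series poly_series_ord mdefM lin_sumE subrr.
Qed.

Lemma obs_moduleE M (D : moduleDeformation n M) x :
  obs_module_fun D x = mult_defect D (x ord0) (x ord_max) n.+1.
Proof.
apply: linear_ext => m; rewrite lin_addE !lin_oppE lin_sumE comp_poly_seriesE.
rewrite /mdef_series poly_series_out // lin_zeroE add0r.
by congr (- _); apply: eq_bigl => p; rewrite obs_indexE.
Qed.

(** Associativity, of the algebra for X(abc) and of composition for X(a)X(b)X(c),
makes all the terms cancel in pairs. *)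
Lemma mult_defect_cocycle M (D : moduleDeformation n M) a b c :
  mdef_series D a ⋆ mult_defect D b c - mult_defect D (a ** b) c
    + mult_defect D a (b ** c) - mult_defect D a b ⋆ mdef_series D c = 0.
Proof.
rewrite /mult_defect comp_seriesBl comp_seriesBr comp_seriesA amulA opprB.
set p := _ ⋆ mdef_series D (b ** c); set q := mdef_series D (a ** b) ⋆ _.
set r := mdef_series D (a ** (b ** c)); set s := _ ⋆ _ ⋆ _.
rewrite opprB -[X in X + _]addrA (addrA (q - r)) subrK.
by rewrite [p - s + _]addrC [q - p + _]addrA subrK [LHS]addrA subrK subrr.
Qed.

Section HomDeformation.
Variables (M N : leftModule A) (phi : moduleHom M N) (D : homDeformation n phi).

Definition hom_series : series M N := poly_series (phit D).

Definition hom_defect a : series M N :=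
  mdef_series (eta D) a ⋆ hom_series - hom_series ⋆ mdef_series (xi D) a.

Lemma hom_series0 : hom_series 0%N = phi.
Proof. by rewrite -(phit0 D) -(poly_series_ord (phit D) ord0). Qed.

Lemma hom_defect_vanishes a : vanishes n (hom_defect a).
Proof.
move=> l ln; apply: linear_ext => x; rewrite lin_zeroE lin_addE lin_oppE.
have -> : l = Ordinal (ln : (l < n.+1)%N) by [].
by rewrite !comp_poly_seriesE phitM subrr.
Qed.

Lemma obs_homE x : obs_hom_fun D x = hom_defect (x ord0) n.+1.
Proof.
apply: linear_ext => m.
rewrite /hom_defect /mdef_series /hom_series.
rewrite !lin_addE !lin_oppE !comp_poly_seriesE !lin_sumE.
by congr (_ - _); apply: eq_bigl => p; rewrite obs_indexE.
Qed.

(** Inserting S(a) and S(b) in succession moves Phi across X(a)X(b), while S(ab)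
moves it across X(ab); the difference of the two routes is the difference
between the multiplicativity defects. *)
Lemma hom_defect_coboundary a b :
  hom_series ⋆ mult_defect (xi D) a b - mult_defect (eta D) a b ⋆ hom_series =
  mdef_series (eta D) a ⋆ hom_defect b - hom_defect (a ** b)
    + hom_defect a ⋆ mdef_series (xi D) b.
Proof.
rewrite /mult_defect /hom_defect !comp_seriesBl !comp_seriesBr !comp_seriesA.
rewrite [RHS]addrAC (addrA (_ - _) _ (- _)) subrK !opprB.
by rewrite addrACA [RHS]addrACA [in RHS](addrC _ (_ ⋆ mdef_series _ (a ** b))).
Qed.

End HomDeformation.

(** * The Hochschild coboundary in low degrees *)

Lemma coboundary1E (F : bimodule A) (f : cochain F 1) x :
  coboundary f x =
  lact F (x ord0) (f (fun=> x ord_max)) - f (fun=> x ord0 ** x ord_max)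
    + ract F (x ord_max) (f (fun=> x ord0)).
Proof.
rewrite /= /coboundary_fun big_ord1 !exprS !expr0 !mulr1 mulrNN mulr1 scaleN1r scale1r.
congr (_ (f _) - f _ + _ (f _)); apply/funext => j; rewrite !ord1 /contract /= //.
- by congr x; apply: val_inj.
- by congr (x _ ** x _); apply: val_inj.
- by congr x; apply: val_inj.
Qed.

Definition pair_arg a b (i : 'I_2) : A := if i == ord0 then a else b.

Lemma coboundary2E (F : bimodule A) (f : cochain F 2) x (x1 := x (lift ord0 ord0)):
  coboundary f x =
  lact F (x ord0) (f (pair_arg x1 (x ord_max)))
    - f (pair_arg (x ord0 ** x1) (x ord_max))
    + f (pair_arg (x ord0) (x1 ** x ord_max))
    - ract F (x ord_max) (f (pair_arg (x ord0) x1)).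
Proof.
have E2 (y z : 'I_2 -> A) : y ord0 = z ord0 -> y ord_max = z ord_max -> y = z.
  move=> e0 e1; apply/funext => -[[|[|//]] lti].
    by rewrite (_ : Ordinal _ = ord0) //; apply: val_inj.
  by rewrite (_ : Ordinal _ = ord_max) //; apply: val_inj.
rewrite /= /coboundary_fun big_ord_recl big_ord1 !exprS !expr0 !mulr1 !mulrNN !mulr1.
rewrite !scaleN1r scale1r addrA.
by congr (_ (f _) - f _ + f _ - _ (f _)); apply: E2;
  rewrite /pair_arg /contract /= ?/x1; congr (x _) || congr (x _ ** x _);
  apply: val_inj.
Qed.

(** * The obstruction is a cocycle *)

(** The coefficient of t^(n+1) in [mult_defect_cocycle]. *)
Lemma obs_module_cocycle M (D : moduleDeformation n M) :
  coboundary (obs_module D) = 0.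
Proof.
apply: val_inj; apply/funext => x.
set a := x ord0; set b := x (lift ord0 ord0); set c := x ord_max.
change (coboundary (obs_module D) x = 0).
rewrite coboundary2E /= !obs_moduleE /pair_arg /=; apply: linear_ext => m.
have := congr1 (fun s : series M M => s n.+1 m) (mult_defect_cocycle D a b c).
rewrite !lin_addE !lin_oppE 
  (comp_series_lead _ _ (mult_defect_vanishes D b c))
  (lead_comp_series _ _ (mult_defect_vanishes D a b)) !mdef_series0 //.
Qed.

(** The coefficient of t^(n+1) in [hom_defect_coboundary]. *)
Lemma obs_hom_coboundary M N (phi : moduleHom M N) (D : homDeformation n phi) :
  postcomp phi (obs_module (xi D)) - precomp phi (obs_module (eta D)) =
  coboundary (obs_hom D).
Proof.
apply: val_inj; apply/funext => x; set a := x ord0; set b := x ord_max.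
change ((phi \o obs_module_fun (xi D) x : {linear M -> N})
  - (obs_module_fun (eta D) x \o phi : {linear M -> N})
  = coboundary (obs_hom D) x).
rewrite coboundary1E /= !obs_moduleE !obs_homE; apply: linear_ext => m.
have := congr1 (fun s : series M N => s n.+1 m) (hom_defect_coboundary D a b).
rewrite !lin_addE !lin_oppE
  (comp_series_lead _ _ (mult_defect_vanishes (xi D) a b))
  (lead_comp_series _ _ (mult_defect_vanishes (eta D) a b))
  (comp_series_lead _ _ (hom_defect_vanishes D b))
  (lead_comp_series _ _ (hom_defect_vanishes D a)).
by rewrite !mdef_series0 hom_series0.
Qed.

End Defects.

Theorem theorem4p1 (k : comPzRingType) (A : assocAlgebra k)
    (M N : leftModule A) (phi : moduleHom M N) (n : nat)
    (D : homDeformation n phi) :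
  module_diff phi (n := 1) (obstruction D) = 0 :> module_cochain M N 3.
Proof.
by rewrite /obstruction /= !obs_module_cocycle obs_hom_coboundary subrr.
Qed.
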